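(* Let $m\geq2$ be an integer. For $\lambda\in[1/(m+1),1/m)$ let $K_\lambda$ be the uniform $\lambda$-Cantor set (with $m$ maps). Then the function $\lambda\mapsto\mathcal{L}(K_\lambda\cdot K_\lambda)$ is continuous on $[1/(m+1),1/m)$, where $\mathcal{L}$ denotes Lebesgue measure on $\mathbb{R}$.
   Context: For an integer $m\geq2$ and $0<\lambda<1/m$, put $g=\frac{1-m\lambda}{m-1}$ and $\delta=\lambda+g$. The uniform $\lambda$-Cantor set $K_\lambda\subset[0,1]$ is the attractor (unique nonempty compact set with $K_\lambda=\bigcup_{i=0}^{m-1}f_i(K_\lambda)$) of the iterated function system $f_i(x)=\lambda x+i\delta$, $0\leq i\leq m-1$. For sets $X,Y\subset\mathbb{R}$, $X\cdot Y=\{xy:x\in X,\ y\in Y\}$. *)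

(* Defs.v *)
From HB Require Import structures.
From mathcomp Require Import all_boot all_order all_algebra.
From mathcomp Require Import all_classical all_reals all_analysis.
From mathcomp Require Import ring lra.

Set Implicit Arguments.
Unset Strict Implicit.
Unset Printing Implicit Defensive.

Import Order.TTheory GRing.Theory Num.Theory.
Import numFieldNormedType.Exports.

Local Open Scope classical_set_scope.
Local Open Scope ring_scope.

Definition cantor_gap (R : realType) (m : nat) (lam : R) : R :=
  (1 - m%:R * lam) / (m%:R - 1).

Definition cantor_step (R : realType) (m : nat) (lam : R) : R :=
  lam + cantor_gap m lam.

Definition cantor_map (R : realType) (m : nat) (lam : R) (i : nat) (x : R) : R :=
  lam * x + i%:R * cantor_step m lam.

Definition is_attractor (R : realType) (m : nat) (f : nat -> R -> R)
    (K : set R) : Prop :=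
  [/\ K !=set0, compact K & K = \bigcup_(i in `I_m) (f i @` K)].

(* The default value [set0] is not used when [1 < m] and [0 < lam < 1 / m]: see
   [uniform_cantor_attractor] and [uniform_cantor_unique]. *)
Definition uniform_cantor (R : realType) (m : nat) (lam : R) : set R :=
  xget set0 [set K | is_attractor m (cantor_map m lam) K].

Definition set_mul (R : realType) (X Y : set R) : set R :=
  [set x * y | x in X & y in Y].

Lemma cantor_map_dist (R : realType) (m : nat) (lam : R) (i : nat) (x y : R) :
  0 < lam -> `|cantor_map m lam i x - cantor_map m lam i y| = lam * `|x - y|.
Proof.
move=> lam0; rewrite /cantor_map -[in RHS](gtr0_norm lam0) -normrM.
by congr `|_|; ring.
Qed.

Lemma is_attractor_unique (R : realType) (m : nat) (lam : R) (K K' : set R) :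
  0 < lam < 1 -> is_attractor m (cantor_map m lam) K ->
  is_attractor m (cantor_map m lam) K' -> K = K'.
Proof.
move=> /andP[lam0 lam1].
suff incl (A B : set R) : is_attractor m (cantor_map m lam) A ->
    is_attractor m (cantor_map m lam) B -> A `<=` B.
  by move=> KA KB; rewrite eqEsubset; split; exact: incl.
move=> [A0 cA eA] [[b Bb] cB eB].
have [MA [_ bM]] := compact_bounded cA.
have bA x : A x -> `|x| <= MA + 1 by apply: bM; rewrite ltrDl.
pose D : R := MA + 1 + `|b|.
have approx n x : A x -> exists2 y, B y & `|x - y| <= lam ^+ n * D.
  elim: n x => [|n IH] x Ax.
    exists b => //; rewrite expr0 mul1r /D.
    by apply: (le_trans (ler_normB _ _)); rewrite lerD2r; exact: bA.
  move: Ax; rewrite eA => -[i /= im [z Az <-]].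
  have [y By zy] := IH _ Az.
  exists (cantor_map m lam i y); first by rewrite eB; exists i => //; exists y.
  by rewrite cantor_map_dist// exprS -mulrA ler_pM2l.
have clB : closed B by apply: compact_closed => //; exact: Rhausdorff.
move=> x Ax; apply: clB => U /nbhs_ballP[e /= e0 eU].
have : (fun n => lam ^+ n * D) @ \oo --> (0 * D : R).
  apply: cvgMl; apply: cvg_expr; by rewrite gtr0_norm.
rewrite mul0r => /cvgr0_norm_lt /(_ e e0) [N _ /(_ N (leqnn N))] /= Ne.
have [y By xy] := approx N x Ax.
exists y; split => //; apply: eU; rewrite /ball /=.
by apply: le_lt_trans xy _; apply: le_lt_trans Ne; exact: ler_norm.
Qed.

Lemma cantor_map_itv (R : realType) (m : nat) (lam : R) (i : nat) (x : R) :
  (1 < m)%N -> 0 < lam < m%:R^-1 -> (i < m)%N ->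
  0 <= x <= 1 -> 0 <= cantor_map m lam i x <= 1.
Proof.
move=> m1 /andP[lam0 lamm] im /andP[x0 x1].
have m0 : 0 < m%:R :> R by rewrite ltr0n ltnW.
have mlam : m%:R * lam < 1 by rewrite mulrC -ltr_pdivlMr// div1r.
have m1R : 0 < m%:R - 1 :> R by rewrite subr_gt0 ltr1n.
have g0 : 0 <= cantor_step m lam.
  by rewrite addr_ge0 ?ltW// divr_gt0// subr_gt0.
have iR : i%:R <= m%:R - 1 :> R by rewrite lerBrDr natr1 ler_nat.
apply/andP; split.
  by rewrite addr_ge0 ?mulr_ge0// ltW.
have -> : 1 = lam * 1 + (m%:R - 1) * cantor_step m lam.
  by rewrite /cantor_step /cantor_gap; field; rewrite gt_eqF.
by rewrite lerD ?ler_wpM2l// ?ler_wpM2r// ltW.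
Qed.

Lemma is_attractor_exists (R : realType) (m : nat) (lam : R) :
  (1 < m)%N -> 0 < lam < m%:R^-1 ->
  exists K, is_attractor m (cantor_map m lam) K.
Proof.
move=> m1 lamP; have /andP[lam0 _] := lamP.
pose f := cantor_map m lam.
pose S (A : set R) := \bigcup_(i in `I_m) (f i @` A).
pose T n := iter n S [set` `[0, 1]].
have fC i : continuous (f i).
  move=> x; apply: cvgD; last exact: cvg_cst.
  by apply: cvgMr; exact: cvg_id.
have S_sub A B : A `<=` B -> S A `<=` S B.
  by move=> AB x [i im [y Ay <-]]; exists i => //; exists y => //; exact: AB.
have TS n : T n.+1 `<=` T n.
  elim: n => [|n IH]; last exact: S_sub IH.
  move=> _ [i /= im [y y01 <-]] /=; move: y01 => /=; rewrite !in_itv /=.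
  exact: cantor_map_itv.
have Tle n p : (n <= p)%N -> T p `<=` T n.
  elim: p => [|p IH]; first by rewrite leqn0 => /eqP ->.
  rewrite leq_eqVlt => /predU1P[-> //|]; rewrite ltnS => /IH np.
  exact: subset_trans (TS p) np.
have Tcl n : compact (T n).
  elim: n => [|n IH]; first exact: segment_compact.
  apply: (subclosed_compact _ (@segment_compact R 0 1)); last exact: (Tle 0%N n.+1).
  apply: closed_bigcup; first exact: finite_II.
  move=> i _; apply: compact_closed; first exact: Rhausdorff.
  apply: continuous_compact IH; exact: continuous_subspaceT.
pose K := \bigcap_n T n.
have f_inj i : injective (f i).
  by move=> x y /addIr /(mulfI (lt0r_neq0 lam0)).
have T00 n : T n 0.
  elim: n => [|n IH]; first by rewrite /= in_itv /= lexx ler01.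
  exists 0%N; first exact: ltnW.
  by exists 0 => //; rewrite /f /cantor_map mulr0 mul0r addr0.
exists K; split.
- by exists 0 => n _; exact: T00.
- apply: (subclosed_compact _ (@segment_compact R 0 1)); last by move=> x /(_ 0%N I).
  apply: closed_bigI => n _; apply: compact_closed => //; exact: Rhausdorff.
- rewrite eqEsubset; split; last first.
    move=> x [i im [y Ky <-]] n _; apply: TS.
    by exists i => //; exists y => //; exact: Ky.
  move=> x Kx; apply: contrapT => nx.
  have bad i : exists n, (i < m)%N -> forall y, T n y -> f i y <> x.
    apply: contrapT => /forallNP h; apply: nx.
    have im : (i < m)%N by apply: contrapT => nim; apply: (h 0%N) => /nim.
    have g n : exists2 y, T n y & f i y = x.
      apply: contrapT => ng; apply: (h n) => _ y Ty fy; apply: ng; by exists y.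
    exists i => //; have [y0 _ fy0] := g 0%N; exists y0 => // n _.
    by have [y Ty fy] := g n; rewrite -(f_inj i y y0)// fy fy0.
  have [N NP] := choice bad.
  have [i /= im [y Ty]] := Kx (\max_(i < m) N i).+1 I.
  apply: (NP i im); apply: Tle Ty.
  exact: (leq_bigmax (F := fun j : 'I_m => N j) (Ordinal im)).
Qed.

Lemma uniform_cantor_attractor (R : realType) (m : nat) (lam : R) :
  (1 < m)%N -> 0 < lam < m%:R^-1 ->
  is_attractor m (cantor_map m lam) (uniform_cantor m lam).
Proof. by move=> m1 /(is_attractor_exists m1); exact: xgetPex. Qed.

Lemma uniform_cantor_unique (R : realType) (m : nat) (lam : R) (K : set R) :
  (1 < m)%N -> 0 < lam < m%:R^-1 ->
  is_attractor m (cantor_map m lam) K -> K = uniform_cantor m lam.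
Proof.
move=> m1 lamP KA.
apply: (is_attractor_unique _ KA); last exact: uniform_cantor_attractor.
have /andP[-> lamm] := lamP; apply: lt_trans lamm _.
by rewrite invf_lt1 ?ltr1n// ltr0n ltnW.
Qed.

(* Main.v *)
Require Import Defs.
From mathcomp Require Import all_boot all_order all_algebra.
From mathcomp Require Import all_classical all_reals all_analysis.
From mathcomp Require Import ring lra.

(** Write K for K_lam, and let I_w be the level-n interval, of length lam^n,
    attached to a word w. If I_v and I_w are disjoint with v, w starting with a
    nonzero digit, then I_v * I_w is covered by the products of their
    subintervals, which are again disjoint and away from 0; hence by compactness
    (K :&: I_v) * (K :&: I_w) = I_v * I_w. Since K is 0 together with the
    lam^k-copies of its part with nonzero first digit, K * K is a finite union
    of intervals with endpoints continuous in lam (the lam^k * I_v * I_w with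
    v <> w and k < N), up to [0, lam^N] and the squares lam^k * I_w * I_w, of
    total length at most lam^N + 3 N (m lam)^n. As m lam < 1, this error is
    small locally uniformly in lam. *)

Import Order.TTheory GRing.Theory Num.Theory.
Import numFieldNormedType.Exports.

Local Open Scope classical_set_scope.
Local Open Scope ring_scope.

Set Implicit Arguments.
Unset Strict Implicit.

(** * Subdividing a product of two intervals *)

(** Peel off the last interval: if [z] exceeds [U n], the overlap condition puts it above [L n.+1];
    otherwise recurse. *)
Lemma chain_cover (R : realType) (L U : nat -> R) (n : nat) (z : R) :
  L 0%N <= z <= U n -> (forall i, (i < n)%N -> L i.+1 <= U i) ->
  exists2 i, (i <= n)%N & L i <= z <= U i.
Proof.
move=> /andP[L0 Un]; elim: n Un => [|n IH] Un ov.
  by exists 0%N => //; rewrite L0.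
have [zU|zU] := leP z (U n).
  have [i ni zi] := IH zU (fun i im => ov i (ltnW im)).
  by exists i => //; exact: ltnW.
by exists n.+1 => //; rewrite Un (le_trans (ov n (leqnn _)))// ltW.
Qed.

(** Says that the last map fixes 1. *)
Lemma cantor_stepE (R : realType) (m : nat) (lam : R) :
  (1 < m)%N -> (m.-1)%:R * cantor_step m lam = 1 - lam.
Proof.
case: m => [//|m] /= m1; rewrite /cantor_step /cantor_gap.
have m0 : m%:R != 0 :> R by rewrite pnatr_eq0 -lt0n -ltnS.
have -> : m.+1%:R = m%:R + 1 :> R by rewrite natr1.
by field; rewrite addrK.
Qed.

Lemma cantor_gap_gt0 (R : realType) (m : nat) (lam : R) :
  (1 < m)%N -> 0 < lam < m%:R^-1 -> 0 < cantor_gap m lam.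
Proof.
move=> m1 /andP[lam0 lamm]; rewrite divr_gt0 ?subr_gt0 ?ltr1n//.
by rewrite mulrC -ltr_pdivlMr ?div1r// ltr0n ltnW.
Qed.

(** Clearing the denominator leaves [1 <= (2m - 1) lam], which follows from [1 <= (m + 1) lam] since
    [m >= 2]. This is how the lower bound on [lam] reaches the overlap arguments. *)
Lemma cantor_gap_le (R : realType) (m : nat) (lam : R) :
  (1 < m)%N -> m.+1%:R^-1 <= lam -> cantor_gap m lam <= lam.
Proof.
move=> m1 h; have lam0 : 0 <= lam by rewrite (le_trans _ h)// invr_ge0.
move: h; rewrite /cantor_gap -[_^-1]div1r ler_pdivrMr ?ltr0n// => h.
have m2 : 2 <= m%:R :> R by rewrite ler_nat.
rewrite ler_pdivrMr; last by lra.
by rewrite -natr1 in h; nra.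
Qed.

(* For fixed [i] the products [I_i * J_j] overlap successively in [j]; their
   unions over [j] then overlap successively in [i]. *)
Lemma prod_subdivision (R : realType) (m : nat) (lam a b t z : R) :
  (1 < m)%N -> 0 < lam < m%:R^-1 -> cantor_gap m lam <= lam ->
  0 < a -> 0 < t -> a + t <= b -> cantor_gap m lam * (b + t) <= a ->
  a * b <= z <= (a + t) * (b + t) ->
  exists i j, [/\ (i < m)%N, (j < m)%N &
    (a + t * (i%:R * cantor_step m lam)) * (b + t * (j%:R * cantor_step m lam))
    <= z <= (a + t * (i%:R * cantor_step m lam) + t * lam) *
            (b + t * (j%:R * cantor_step m lam) + t * lam)].
Proof.
move=> m1 lamP glam a0 t0 ab ga zP.
have g0 := cantor_gap_gt0 m1 lamP; have /andP[lam0 _] := lamP.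
have sE := cantor_stepE lam m1.
have sg : cantor_step m lam = lam + cantor_gap m lam by [].
set g := cantor_gap m lam in glam ga g0 sg; set s := cantor_step m lam in sE sg *.
have s0 : 0 < s by lra.
have ovi i : (i < m.-1)%N ->
    (a + t * (i.+1%:R * s)) * b <= (a + t * (i%:R * s) + t * lam) * (b + t).
  move=> _; have i0 : 0 <= i%:R :> R by rewrite ler0n.
  rewrite -natr1; set x : R := i%:R in i0 *.
  have h : 0 <= t * (x * s) by rewrite !mulr_ge0// ltW.
  rewrite -subr_ge0.
  (* Overlap of consecutive rows comes down to [g * b <= a], a consequence of [ga]. *)
  have -> : (a + t * (x * s) + t * lam) * (b + t) - (a + t * ((x + 1) * s)) * b
    = t * (t * (x * s) + (a - g * b) + t * lam) by rewrite sg; ring.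
  by rewrite mulr_ge0 ?ltW//; nra.
have zi0 : (a + t * (0%:R * s)) * b <= z <=
    (a + t * (m.-1%:R * s) + t * lam) * (b + t).
  rewrite mul0r mulr0 addr0 sE.
  by have -> : a + t * (1 - lam) + t * lam = a + t by ring.
have [i im zi] := @chain_cover R (fun i => (a + t * (i%:R * s)) * b)
  (fun i => (a + t * (i%:R * s) + t * lam) * (b + t)) _ _ zi0 ovi.
set A := a + t * (i%:R * s) in zi.
have i0 : 0 <= t * (i%:R * s) by rewrite !mulr_ge0 ?ler0n// ltW.
have iR : t * (i%:R * s) <= t * (1 - lam).
  by rewrite ler_pM2l// -sE ler_pM2r// ler_nat.
have ovj j : (j < m.-1)%N ->
    A * (b + t * (j.+1%:R * s)) <= (A + t * lam) * (b + t * (j%:R * s) + t * lam).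
  move=> _; have j0 : 0 <= j%:R :> R by rewrite ler0n.
  rewrite -natr1; set x : R := j%:R in j0 *.
  have h : 0 <= t * (x * s) by rewrite !mulr_ge0// ltW.
  rewrite -subr_ge0.
  (* Overlap within a row: this grouping is a sum of nonnegative terms once [A <= b] and [g <= lam].
     The former holds because [A <= a + t * (1 - lam)]. *)
  have -> : (A + t * lam) * (b + t * (x * s) + t * lam) - A * (b + t * ((x + 1) * s))
    = t * (lam * (b - A) + (lam - g) * A + lam * (t * (x * s)) + t * lam * lam).
    by rewrite sg; ring.
  have Ab : A <= b by rewrite /A; nra.
  have A0 : 0 <= A by rewrite /A; lra.
  have l0 := ltW lam0; have t0' := ltW t0.
  have p1 : 0 <= lam * (b - A) by rewrite mulr_ge0// subr_ge0.
  have p2 : 0 <= (lam - g) * A by rewrite mulr_ge0// subr_ge0.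
  rewrite mulr_ge0//; rewrite !addr_ge0//; first exact: mulr_ge0.
  by apply: mulr_ge0 => //; exact: mulr_ge0.
have zj0 : A * (b + t * (0%:R * s)) <= z <=
    (A + t * lam) * (b + t * (m.-1%:R * s) + t * lam).
  rewrite mul0r mulr0 addr0 sE.
  by have -> : b + t * (1 - lam) + t * lam = b + t by ring.
have [j jm zj] := @chain_cover R (fun j => A * (b + t * (j%:R * s)))
  (fun j => (A + t * lam) * (b + t * (j%:R * s) + t * lam)) _ _ zj0 ovj.
by exists i, j; split => //; rewrite -[m](@prednK m) ?ltnS// ltnW.
Qed.

(** * Elementary properties of the Cantor set *)

Lemma ratio_lt1 (R : realType) (m : nat) (lam : R) :
  (1 < m)%N -> 0 < lam < m%:R^-1 -> lam < 1.
Proof.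
move=> m1 /andP[_ lamm]; apply: lt_trans lamm _.
by rewrite invf_lt1 ?ltr1n// ltr0n ltnW.
Qed.

(** The maps preserve [0, 1] and contract by [lam], so points of [0, 1] come within
    [lam ^+ n * (M + 1)] of any point of the attractor; [0, 1] is closed. *)
Lemma cantor_itv (R : realType) (m : nat) (lam x : R) :
  (1 < m)%N -> 0 < lam < m%:R^-1 -> uniform_cantor m lam x -> 0 <= x <= 1.
Proof.
move=> m1 lamP Kx; have /andP[lam0 _] := lamP.
have [_ cK eK] := uniform_cantor_attractor m1 lamP.
have lam1 := ratio_lt1 m1 lamP.
have [M [_ bM]] := compact_bounded cK.
have bK y : uniform_cantor m lam y -> `|y| <= M + 1 by apply: bM; rewrite ltrDl.
have approx n y : uniform_cantor m lam y ->
    exists2 y', 0 <= y' <= 1 & `|y - y'| <= lam ^+ n * (M + 1).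
  elim: n y => [|n IH] y Ky.
    by exists 0; rewrite ?lexx ?ler01// expr0 mul1r subr0 bK.
  move: Ky; rewrite eK => -[i /= im [u Ku <-]].
  have [v v01 uv] := IH _ Ku.
  exists (cantor_map m lam i v); first exact: cantor_map_itv.
  by rewrite cantor_map_dist// exprS -mulrA ler_pM2l.
have : closed (`[0, 1] : set R) by exact: interval_closed.
have -> : (0 <= x <= 1) = (x \in `[0, 1]) by rewrite in_itv.
apply => U /nbhs_ballP[e /= e0 eU].
have : (fun n => lam ^+ n * (M + 1)) @ \oo --> (0 * (M + 1) : R).
  by apply: cvgMr_tmp; apply: cvg_expr; rewrite gtr0_norm.
rewrite mul0r => /cvgr0_norm_lt /(_ e e0) [N _ /(_ N (leqnn N))] /= Ne.
have [y y01 xy] := approx N x Kx.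
exists y; split => /=; first by rewrite in_itv.
apply: eU; rewrite /ball /=.
by apply: le_lt_trans xy _; apply: le_lt_trans Ne; exact: ler_norm.
Qed.

Lemma cantor_map_in (R : realType) (m : nat) (lam x : R) (i : nat) :
  (1 < m)%N -> 0 < lam < m%:R^-1 -> (i < m)%N ->
  uniform_cantor m lam x -> uniform_cantor m lam (cantor_map m lam i x).
Proof.
move=> m1 lamP im Kx; have [_ _ ->] := uniform_cantor_attractor m1 lamP.
by exists i => //; exists x.
Qed.

Lemma cantor_scale (R : realType) (m : nat) (lam x : R) (k : nat) :
  (1 < m)%N -> 0 < lam < m%:R^-1 ->
  uniform_cantor m lam x -> uniform_cantor m lam (lam ^+ k * x).
Proof.
move=> m1 lamP Kx; elim: k => [|k IH]; first by rewrite mul1r.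
have := cantor_map_in m1 lamP (ltnW m1) IH.
by rewrite /cantor_map mul0r addr0 mulrA -exprS.
Qed.

(** 0 is the limit of the iterates [lam ^+ n * b] of the first map at any point [b] of the closed
    attractor. *)
Lemma cantor0 (R : realType) (m : nat) (lam : R) :
  (1 < m)%N -> 0 < lam < m%:R^-1 -> uniform_cantor m lam 0.
Proof.
move=> m1 lamP; have /andP[lam0 _] := lamP; have lam1 := ratio_lt1 m1 lamP.
have [[b Kb] cK _] := uniform_cantor_attractor m1 lamP.
have clK : closed (uniform_cantor m lam).
  by apply: compact_closed => //; exact: Rhausdorff.
apply: (@closed_cvg _ _ \oo _ (fun n => lam ^+ n * b) _ clK).
  by apply: nearW => n; exact: cantor_scale.
rewrite -[in X in _ --> X](mul0r b).
by apply: cvgMr_tmp; apply: cvg_expr; rewrite gtr0_norm.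
Qed.

(** * Products of two separated copies of the Cantor set *)

Lemma compact_set_mul (R : realType) (X Y : set R) :
  compact X -> compact Y -> compact (set_mul X Y).
Proof.
move=> cX cY.
have -> : set_mul X Y = (fun p : R * R => p.1 * p.2) @` (X `*` Y).
  rewrite eqEsubset; split => z.
    by move=> [x Xx [y Yy <-]]; exists (x, y).
  by move=> [[x y] [/= Xx Yy] <-]; exists x => //; exists y.
apply: continuous_compact; last exact: compact_setX.
apply: continuous_subspaceT => p.
by apply: cvgM; [exact: cvg_fst | exact: cvg_snd].
Qed.

Lemma compact_affine (R : realType) (X : set R) (a t : R) :
  compact X -> compact [set a + t * x | x in X].
Proof.
move=> cX; apply: continuous_compact => //.
apply: continuous_subspaceT => x; apply: cvgD; first exact: cvg_cst.
by apply: cvgMl_tmp; exact: cvg_id.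
Qed.

(** Iterates [prod_subdivision]. Its hypotheses pass to the chosen subintervals: both have length
    [t * lam], they stay separated, the left endpoint [a] does not decrease and the right endpoint
    [b + t] does not increase. *)
Lemma prod_itv_approx (R : realType) (m : nat) (lam a b t z : R) (n : nat) :
  (1 < m)%N -> 0 < lam < m%:R^-1 -> cantor_gap m lam <= lam ->
  0 < a -> 0 < t -> a + t <= b -> cantor_gap m lam * (b + t) <= a ->
  a * b <= z <= (a + t) * (b + t) ->
  exists2 x, uniform_cantor m lam x & exists2 y, uniform_cantor m lam y &
    (a + t * x) * (b + t * y) <= z <=
    (a + t * x + t * lam ^+ n) * (b + t * y + t * lam ^+ n).
Proof.
move=> m1 lamP glam; have /andP[lam0 _] := lamP.
have g0 := cantor_gap_gt0 m1 lamP.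
elim: n a b t => [|n IH] a b t a0 t0 ab ga zP.
  exists 0; first exact: cantor0.
  by exists 0; [exact: cantor0 | rewrite !mulr0 !addr0 !mulr1].
have [i [j [im jm zij]]] := prod_subdivision m1 lamP glam a0 t0 ab ga zP.
have s0 : 0 <= cantor_step m lam by rewrite addr_ge0// ltW.
have sub k : (k < m)%N -> 0 <= t * (k%:R * cantor_step m lam) <= t * (1 - lam).
  move=> km; apply/andP; split.
    by rewrite mulr_ge0 ?(ltW t0)// mulr_ge0.
  rewrite ler_pM2l// -(cantor_stepE _ m1).
  by rewrite ler_wpM2r// ler_nat -ltnS prednK// ltnW.
have /andP[i0 i1] := sub i im; have /andP[j0 j1] := sub j jm.
have [||||x Kx [y Ky xy]] := IH _ _ (t * lam) _ _ _ _ zij.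
- by rewrite ltr_pwDl.
- exact: mulr_gt0.
- by lra.
- apply: le_trans (_ : a <= _); last by rewrite lerDl.
  by apply: (le_trans _ ga); rewrite ler_pM2l//; lra.
exists (cantor_map m lam i x); first exact: cantor_map_in.
exists (cantor_map m lam j y); first exact: cantor_map_in.
move: xy; rewrite /cantor_map exprS.
set s := cantor_step m lam; set l := lam ^+ n.
have e (u : R) k v : u + t * (lam * v + k * s) = u + t * (k * s) + t * lam * v by ring.
by rewrite !e !mulrA.
Qed.

(** The set [P] of products is compact, hence closed, and [prod_itv_approx] supplies elements of it
    arbitrarily close to [z]. *)
Lemma prod_itv_cover (R : realType) (m : nat) (lam a b t z : R) :
  (1 < m)%N -> 0 < lam < m%:R^-1 -> cantor_gap m lam <= lam ->
  0 < a -> 0 < t -> a + t <= b -> cantor_gap m lam * (b + t) <= a ->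
  a * b <= z <= (a + t) * (b + t) ->
  exists2 x, uniform_cantor m lam x & exists2 y, uniform_cantor m lam y &
    z = (a + t * x) * (b + t * y).
Proof.
move=> m1 lamP glam a0 t0 ab ga zP; have /andP[lam0 _] := lamP.
have lam1 := ratio_lt1 m1 lamP.
have [_ cK _] := uniform_cantor_attractor m1 lamP.
pose P := set_mul [set a + t * x | x in uniform_cantor m lam]
                  [set b + t * x | x in uniform_cantor m lam].
have clP : closed P.
  apply: compact_closed; first exact: Rhausdorff.
  by apply: compact_set_mul; exact: compact_affine.
suff [_ [x Kx <-] [_ [y Ky <-] <-]] : P z by exists x => //; exists y.
apply: clP => U /nbhs_ballP[e /= e0 eU].
(* With [u <= a + t], [v <= b + t] and [l <= 1], the error [(u + t * l) * (v + t * l) - u * v]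
   equals [t * l * (u + v + t * l)], hence is at most [l * D]. *)
pose D := t * (a + t + (b + t) + t).
have : (fun n => lam ^+ n * D) @ \oo --> (0 * D : R).
  by apply: cvgMr_tmp; apply: cvg_expr; rewrite gtr0_norm.
rewrite mul0r => /cvgr0_norm_lt /(_ e e0) [N _ /(_ N (leqnn N))] /= Ne.
have [x Kx [y Ky /andP[zl zr]]] := prod_itv_approx N m1 lamP glam a0 t0 ab ga zP.
exists ((a + t * x) * (b + t * y)); split.
  by exists (a + t * x); [exists x | exists (b + t * y) => //; exists y].
apply: eU; rewrite /ball /= ger0_norm ?subr_ge0//.
apply: le_lt_trans Ne; apply: le_trans (ler_norm _).
have /andP[x0 x1] := cantor_itv m1 lamP Kx.
have /andP[y0 y1] := cantor_itv m1 lamP Ky.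
have l0 : 0 <= lam ^+ N by rewrite exprn_ge0// ltW.
have l1 : lam ^+ N <= 1 by rewrite exprn_ile1// ltW.
set l := lam ^+ N in zr l0 l1 *.
have tx : t * x <= t by rewrite ger_pMr.
have ty : t * y <= t by rewrite ger_pMr.
have tl : t * l <= t by rewrite ger_pMr.
have tl0 : 0 <= t * l by rewrite mulr_ge0// ltW.
apply: (@le_trans _ _ ((t * l) * ((a + t * x) + (b + t * y) + t * l))).
  by move: zr; set u := a + t * x; set v := b + t * y => zr; nra.
rewrite /D mulrCA mulrA ler_wpM2l//; lra.
Qed.

(** * Words and their intervals *)

(* The left endpoint of the interval [f_{w_1} (... (f_{w_n} [0, 1]))]. *)
Definition cantor_point (R : realType) (m : nat) (lam : R) (w : seq 'I_m) : R :=
  foldr (fun i : 'I_m => cantor_map m lam i) 0 w.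

Lemma cantor_point_in (R : realType) (m : nat) (lam x : R) (w : seq 'I_m) :
  (1 < m)%N -> 0 < lam < m%:R^-1 -> uniform_cantor m lam x ->
  uniform_cantor m lam (cantor_point lam w + lam ^+ size w * x).
Proof.
move=> m1 lamP Kx; elim: w => [|i w IH] /=; first by rewrite add0r mul1r.
have := cantor_map_in m1 lamP (ltn_ord i) IH; congr uniform_cantor.
by rewrite /cantor_map exprS; ring.
Qed.

Lemma cantor_pointP (R : realType) (m : nat) (lam x : R) (n : nat) :
  (1 < m)%N -> 0 < lam < m%:R^-1 -> uniform_cantor m lam x ->
  exists (w : n.-tuple 'I_m) y,
    uniform_cantor m lam y /\ x = cantor_point lam w + lam ^+ n * y.
Proof.
move=> m1 lamP; elim: n x => [|n IH] x Kx.
  by exists [tuple], x; rewrite /= add0r mul1r.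
move: Kx; have [_ _ {1}->] := uniform_cantor_attractor m1 lamP.
move=> [i /= im [u /IH[w [y [Ky ->]]] <-]].
exists [tuple of Ordinal im :: w], y; split => //=.
by rewrite /cantor_map exprS; ring.
Qed.

Lemma cantor_point_itv (R : realType) (m : nat) (lam : R) (w : seq 'I_m) :
  (1 < m)%N -> 0 < lam < m%:R^-1 ->
  0 <= cantor_point lam w <= 1 - lam ^+ size w.
Proof.
move=> m1 lamP; have /andP[lam0 _] := lamP.
have g0 := cantor_gap_gt0 m1 lamP.
have s0 : 0 <= cantor_step m lam by rewrite addr_ge0// ltW.
elim: w => [|i w /andP[w0 w1]] /=; first by rewrite subrr lexx.
have l0 := ltW lam0; rewrite /cantor_map exprS.
apply/andP; split; first by rewrite addr_ge0// mulr_ge0.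
have : i%:R * cantor_step m lam <= 1 - lam.
  by rewrite -(cantor_stepE _ m1) ler_wpM2r// ler_nat -ltnS prednK// ltnW.
by nra.
Qed.

(** The first letter at which the words differ decides the order: there the images of [0, 1] are a
    positive gap apart, and a common prefix acts by an increasing map of ratio a power of [lam]. *)
Lemma cantor_point_sep (R : realType) (m n : nat) (lam : R) (v w : seq 'I_m) :
  (1 < m)%N -> 0 < lam < m%:R^-1 -> size v = n -> size w = n -> v <> w ->
  cantor_point lam v + lam ^+ n <= cantor_point lam w \/
  cantor_point lam w + lam ^+ n <= cantor_point lam v.
Proof.
move=> m1 lamP; have /andP[lam0 _] := lamP.
have g0 := cantor_gap_gt0 m1 lamP.
have sg : cantor_step m lam = lam + cantor_gap m lam by [].
elim: n v w => [|n IH] [|i v] [|j w]//= [sv] [sw] vw.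
have lt_head (k l : 'I_m) (v' w' : seq 'I_m) : size v' = n -> (k < l)%N ->
    cantor_map m lam k (cantor_point lam v') + lam ^+ n.+1 <=
    cantor_map m lam l (cantor_point lam w').
  move=> sv' kl; rewrite /cantor_map exprS.
  have /andP[_] := cantor_point_itv v' m1 lamP; rewrite sv'.
  have /andP[] := cantor_point_itv w' m1 lamP.
  have : k%:R + 1 <= l%:R :> R by rewrite natr1 ler_nat.
  by move: g0 lam0; rewrite sg; nra.
have [ij|ji|/val_inj ij] := ltngtP i j; [left; exact: lt_head | right; exact: lt_head |].
have vw' : v <> w by move=> e; apply: vw; rewrite ij e.
by case: (IH v w sv sw vw') => h; [left|right]; rewrite ij /cantor_map exprS; nra.
Qed.

(** Selects words whose interval stays away from 0; the empty word, with interval [0, 1], is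
    excluded. *)
Definition positive_head (m : nat) (w : seq 'I_m) : bool :=
  if w is i :: _ then (0 < i)%N else false.

Lemma cantor_point_ge (R : realType) (m : nat) (lam : R) (w : seq 'I_m) :
  (1 < m)%N -> 0 < lam < m%:R^-1 -> positive_head w ->
  cantor_step m lam <= cantor_point lam w.
Proof.
move=> m1 lamP; have /andP[lam0 _] := lamP.
have g0 := cantor_gap_gt0 m1 lamP.
case: w => [//|i w] /= i0; have /andP[w0 _] := cantor_point_itv w m1 lamP.
have s0 : 0 <= cantor_step m lam by rewrite addr_ge0// ltW.
have l0 := ltW lam0; rewrite /cantor_map -[X in X <= _]add0r lerD ?mulr_ge0//.
by rewrite ler_peMl// ler1n.
Qed.

(** * Word products inside and around the product set *)

(** Once the two words are ordered by [cantor_point_sep], [prod_itv_cover] applies: the smaller left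
    endpoint is at least [cantor_step], which exceeds the gap, and the larger right endpoint is at
    most 1. The factor [lam ^+ k] is absorbed into one factor by [cantor_scale]. *)
Lemma word_prod_subset (R : realType) (m n k : nat) (lam z : R) (v w : n.-tuple 'I_m) :
  (1 < m)%N -> 0 < lam < m%:R^-1 -> cantor_gap m lam <= lam ->
  positive_head v -> positive_head w -> v <> w ->
  lam ^+ k * (cantor_point lam v * cantor_point lam w) <= z <=
  lam ^+ k * ((cantor_point lam v + lam ^+ n) * (cantor_point lam w + lam ^+ n)) ->
  set_mul (uniform_cantor m lam) (uniform_cantor m lam) z.
Proof.
move=> m1 lamP glam; have /andP[lam0 _] := lamP.
have g0 := cantor_gap_gt0 m1 lamP.
have t0 : 0 < lam ^+ n by rewrite exprn_gt0.
have l0 : 0 < lam ^+ k by rewrite exprn_gt0.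
have ordered (u u' : n.-tuple 'I_m) : positive_head u ->
    cantor_point lam u + lam ^+ n <= cantor_point lam u' ->
    lam ^+ k * (cantor_point lam u * cantor_point lam u') <= z <=
    lam ^+ k * ((cantor_point lam u + lam ^+ n) * (cantor_point lam u' + lam ^+ n)) ->
    set_mul (uniform_cantor m lam) (uniform_cantor m lam) z.
  move=> pu uu' zP; have ug := cantor_point_ge m1 lamP pu.
  have sg : cantor_step m lam = lam + cantor_gap m lam by [].
  have /andP[u0' u1'] := cantor_point_itv u' m1 lamP; rewrite size_tuple in u1'.
  have zP' : cantor_point lam u * cantor_point lam u' <= z / lam ^+ k <=
      (cantor_point lam u + lam ^+ n) * (cantor_point lam u' + lam ^+ n).
    by rewrite ler_pdivlMr// ler_pdivrMr// ![_ * lam ^+ k]mulrC.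
  have [||x Kx [y Ky zE]] := prod_itv_cover m1 lamP glam _ t0 uu' _ zP'.
  - by lra.
  - by nra.
  exists (lam ^+ k * (cantor_point lam u + lam ^+ n * x)).
    apply: cantor_scale => //.
    by have := cantor_point_in u m1 lamP Kx; rewrite size_tuple.
  exists (cantor_point lam u' + lam ^+ n * y).
    by have := cantor_point_in u' m1 lamP Ky; rewrite size_tuple.
  by rewrite -mulrA -zE mulrC divfK// gt_eqF.
move=> pv pw vw zP.
have vw' : (v : seq _) <> w by move/val_inj.
have [h|h] := cantor_point_sep m1 lamP (size_tuple v) (size_tuple w) vw'.
  exact: (ordered v w).
apply: (ordered w v) => //.
by rewrite (mulrC (cantor_point lam w)) (mulrC (cantor_point _ w + _)).
Qed.

Lemma prod_word_cover (R : realType) (m N n : nat) (lam x y : R) :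
  (1 < m)%N -> 0 < lam < m%:R^-1 ->
  uniform_cantor m lam x -> uniform_cantor m lam y ->
  x * y <= lam ^+ N \/
  exists (k : 'I_N) (v w : n.+1.-tuple 'I_m),
    [/\ positive_head v, positive_head w &
     lam ^+ k * (cantor_point lam v * cantor_point lam w) <= x * y <=
     lam ^+ k * ((cantor_point lam v + lam ^+ n.+1) *
                 (cantor_point lam w + lam ^+ n.+1))].
Proof.
move=> m1 lamP Kx Ky; have /andP[lam0 _] := lamP.
have lam1 := ltW (ratio_lt1 m1 lamP); have l0 := ltW lam0.
have t0 : 0 <= lam ^+ n.+1 by rewrite exprn_ge0.
(* Strip leading zero digits: either [N] of them occur and [u <= lam ^+ N], or a nonzero digit
   appears after [k] zeros. Length [n.+1] leaves room for that digit before the next [n]. *)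
have reduce u : uniform_cantor m lam u -> u <= lam ^+ N \/
    exists k (v : n.+1.-tuple 'I_m) p, [/\ positive_head v, 0 <= p <= 1 &
      u = lam ^+ k * (cantor_point lam v + lam ^+ n.+1 * p)].
  elim: N u {Kx Ky} => [|M IH] u Ku.
    by left; have /andP[_] := cantor_itv m1 lamP Ku.
  move: Ku; have [_ _ {1}->] := uniform_cantor_attractor m1 lamP.
  move=> [i /= im [u' Ku' <-]].
  case: i im => [|i] im.
    rewrite /cantor_map mul0r addr0 (exprS _ M).
    have [uM|[k [v [p [pv p01 ->]]]]] := IH u' Ku'.
      by left; rewrite ler_pM2l.
    by right; exists k.+1, v, p; split => //; rewrite (exprS _ k) -mulrA.
  have [v [q [Kq ->]]] := cantor_pointP n m1 lamP Ku'.
  right; exists 0%N, [tuple of Ordinal im :: v], q; split => //.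
    exact: (cantor_itv m1 lamP Kq).
  by rewrite /= /cantor_map exprS; ring.
have /andP[x0 x1] := cantor_itv m1 lamP Kx.
have /andP[y0 y1] := cantor_itv m1 lamP Ky.
have [xN|[k [v [p [pv /andP[p0 p1] xE]]]]] := reduce x Kx.
  by left; apply: le_trans xN; rewrite ler_piMr.
have [yN|[j [w [q [pw /andP[q0 q1] yE]]]]] := reduce y Ky.
  by left; apply: le_trans yN; rewrite ler_piMl.
have /andP[v0 v1] := cantor_point_itv v m1 lamP; rewrite size_tuple in v1.
have /andP[w0 w1] := cantor_point_itv w m1 lamP; rewrite size_tuple in w1.
have tp0 : 0 <= lam ^+ n.+1 * p by rewrite mulr_ge0.
have tq0 : 0 <= lam ^+ n.+1 * q by rewrite mulr_ge0.
have tp1 : lam ^+ n.+1 * p <= lam ^+ n.+1 by rewrite ler_piMr.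
have tq1 : lam ^+ n.+1 * q <= lam ^+ n.+1 by rewrite ler_piMr.
have xyE : x * y = lam ^+ (k + j) * ((cantor_point lam v + lam ^+ n.+1 * p) *
    (cantor_point lam w + lam ^+ n.+1 * q)).
  by rewrite xE yE exprD mulrACA.
(* The scaling exponents add up; from a total of [N] on, the product falls into [0, [lam ^+ N]]. *)
have [kjN|kjN] := ltnP (k + j) N.
  right; exists (Ordinal kjN), v, w; split => //=; rewrite xyE.
  have kj0 : 0 <= lam ^+ (k + j) by rewrite exprn_ge0.
  by apply/andP; split; rewrite ler_wpM2l// ler_pM// ?addr_ge0// ?lerDl// lerD2l.
left; apply: (@le_trans _ _ (lam ^+ (k + j))); last exact: ler_wiXn2l.
rewrite xyE ler_piMr ?exprn_ge0// mulr_ile1// ?addr_ge0//; lra.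
Qed.

(** * Comparing the measures at two ratios *)

(** Compactness gives measurability; the rest is monotonicity and finite subadditivity. *)
Lemma lebesgue_measure_cover (R : realType) (I : finType) (a b : I -> R)
    (A B : set R) :
  compact A -> compact B -> (forall i, a i <= b i) ->
  (forall x, A x -> B x \/ exists i, a i <= x <= b i) ->
  (lebesgue_measure A <= lebesgue_measure B + (\sum_i (b i - a i))%:E)%E.
Proof.
move=> cA cB ab AB.
have mA := measurable_realfun.compact_measurable cA.
have mB := measurable_realfun.compact_measurable cB.
pose C := \big[setU/set0]_(i : I) [set` `[a i, b i]].
have mC : measurable C by apply: bigsetU_measurable => i _; exact: measurable_itv.
have muC : (lebesgue_measure C <= (\sum_i (b i - a i))%:E)%E.
  rewrite /C; elim: (index_enum I) => [|i s IH].
    by rewrite !big_nil measure0.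
  rewrite !big_cons EFinD; apply: le_trans (measureU2 _ _ _) _.
  - exact: measurable_itv.
  - by apply: bigsetU_measurable => j _; exact: measurable_itv.
  apply: leeD IH.
  change (lebesgue_measure [set` `[a i, b i]] <= (b i - a i)%:E)%E.
  rewrite lebesgue_measure_itv /= lte_fin.
  by case: ifPn => // _; rewrite lee_fin subr_ge0.
apply: (@le_trans _ _ (lebesgue_measure (B `|` C))).
  apply: le_measure; rewrite ?inE//; first exact: measurableU.
  move=> x /AB[Bx|[i xi]]; [by left|right].
  by rewrite /C -bigcup_seq; exists i => /=; rewrite ?mem_index_enum// in_itv.
have BC : (lebesgue_measure (B `|` C) <= lebesgue_measure B + lebesgue_measure C)%E.
  exact: measureU2.
by apply: le_trans BC _; rewrite leeD2l.
Qed.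

(* Endpoints of [lam^k * I_v * I_w] for [p = (k, v, w)]. *)
Definition word_prod_lo (R : realType) (m N n : nat) (lam : R)
    (p : 'I_N * n.-tuple 'I_m * n.-tuple 'I_m) : R :=
  lam ^+ p.1.1 * (cantor_point lam p.1.2 * cantor_point lam p.2).

Definition word_prod_hi (R : realType) (m N n : nat) (lam : R)
    (p : 'I_N * n.-tuple 'I_m * n.-tuple 'I_m) : R :=
  lam ^+ p.1.1 *
  ((cantor_point lam p.1.2 + lam ^+ n) * (cantor_point lam p.2 + lam ^+ n)).

(** The length is [lam ^+ k * t * (2 v + t)] with [t = lam ^+ n] and [v + t <= 1]. *)
Lemma word_square_length (R : realType) (m N n : nat) (lam : R) (k : 'I_N)
    (w : n.-tuple 'I_m) :
  (1 < m)%N -> 0 < lam < m%:R^-1 ->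
  0 <= word_prod_hi lam (k, w, w) - word_prod_lo lam (k, w, w) <= lam ^+ n *+ 3.
Proof.
move=> m1 lamP; have /andP[lam0 _] := lamP; have l0 := ltW lam0.
have lam1 := ltW (ratio_lt1 m1 lamP).
have /andP[v0] := cantor_point_itv w m1 lamP; rewrite size_tuple.
rewrite /word_prod_hi /word_prod_lo /= -mulrBr.
have : 0 <= lam ^+ n <= 1 by rewrite exprn_ge0//= exprn_ile1.
have /andP[] : 0 <= lam ^+ k <= 1 by rewrite exprn_ge0//= exprn_ile1.
move: v0; set v := cantor_point _ _; set t := lam ^+ n; set s := lam ^+ k.
move=> v0 s0 s1 /andP[t0 t1] vt.
have -> : (v + t) * (v + t) - v * v = t * (v + v + t) by ring.
have d0 : 0 <= t * (v + v + t) by rewrite mulr_ge0// !addr_ge0.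
rewrite mulr_ge0//=; apply: (@le_trans _ _ (t * (v + v + t))).
  by rewrite ler_piMl.
by rewrite -mulr_natr ler_wpM2l//; lra.
Qed.

(** A product at ratio [lam] lying in a word product with [v <> w] either lies in the same word
    product at [lam'], hence in the product set there, or was passed over by a moving endpoint and
    is within [eta] of [l p] or [h p]. The common reference values [l], [h] let one statement serve
    both directions of the comparison. *)
Lemma cantor_prod_measure_le (R : realType) (m N n : nat) (c eta lam lam' : R)
    (l h : 'I_N * n.+1.-tuple 'I_m * n.+1.-tuple 'I_m -> R) :
  (1 < m)%N -> 0 < lam < m%:R^-1 -> 0 < lam' < m%:R^-1 ->
  cantor_gap m lam' <= lam' -> m%:R * lam <= c -> 0 <= eta ->
  (forall p, `|word_prod_lo lam p - l p| <= eta) ->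
  (forall p, `|word_prod_lo lam' p - l p| <= eta) ->
  (forall p, `|word_prod_hi lam p - h p| <= eta) ->
  (forall p, `|word_prod_hi lam' p - h p| <= eta) ->
  (lebesgue_measure (set_mul (uniform_cantor m lam) (uniform_cantor m lam)) <=
   lebesgue_measure (set_mul (uniform_cantor m lam') (uniform_cantor m lam')) +
   (c ^+ N + c ^+ n.+1 *+ (3 * N) +
    eta *+ (4 * #|{: 'I_N * n.+1.-tuple 'I_m * n.+1.-tuple 'I_m}|))%:E)%E.
Proof.
move=> m1 lamP lamP' glam' lamc eta0 lo lo' hi hi'.
have [_ cK _] := uniform_cantor_attractor m1 lamP.
have [_ cK' _] := uniform_cantor_attractor m1 lamP'.
have /andP[lam0 _] := lamP; have l0 := ltW lam0.
have lam1 := ltW (ratio_lt1 m1 lamP).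
have lamc' : lam <= c by apply: le_trans lamc; rewrite ler_peMl// ler1n ltnW.
have between (u u' v z : R) : `|u - v| <= eta -> `|u' - v| <= eta ->
    u <= z -> z <= u' -> v - eta <= z <= v + eta.
  by rewrite !ler_distl => /andP[vu _] /andP[_ u'v] uz zu';
    rewrite (le_trans vu uz) (le_trans zu' u'v).
set J := ('I_N * n.+1.-tuple 'I_m * n.+1.-tuple 'I_m)%type in l h lo lo' hi hi' *.
pose diag (p : 'I_N * n.+1.-tuple 'I_m) : J := (p.1, p.2, p.2).
(* Exceptional intervals: one for [0, [lam ^+ N]], one for each square, and one around each
   reference endpoint [l p] and [h p]. *)
pose I := (unit + ('I_N * n.+1.-tuple 'I_m) + (J + J))%type.
pose a (i : I) : R := match i with
  | inl (inl _) => 0 | inl (inr p) => word_prod_lo lam (diag p)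
  | inr (inl p) => l p - eta | inr (inr p) => h p - eta end.
pose b (i : I) : R := match i with
  | inl (inl _) => lam ^+ N | inl (inr p) => word_prod_hi lam (diag p)
  | inr (inl p) => l p + eta | inr (inr p) => h p + eta end.
have diag_len p : 0 <= word_prod_hi lam (diag p) - word_prod_lo lam (diag p)
    <= lam ^+ n.+1 *+ 3 by exact: word_square_length.
apply: le_trans (lebesgue_measure_cover (a := a) (b := b)
  (compact_set_mul cK cK) (compact_set_mul cK' cK') _ _) _.
- case=> [[_|p]|[p|p]] /=; rewrite ?exprn_ge0//; last 2 first.
    1,2: by rewrite lerD2l ge0_cp.
  by rewrite -subr_ge0; case/andP: (diag_len p).
- move=> _ [x Kx [y Ky <-]].
  have x0 : 0 <= x by have /andP[] := cantor_itv m1 lamP Kx.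
  have y0 : 0 <= y by have /andP[] := cantor_itv m1 lamP Ky.
  have [xyN|[k [v [w [pv pw xyP]]]]] := prod_word_cover N n m1 lamP Kx Ky.
    by right; exists (inl (inl tt)); rewrite /= mulr_ge0.
  have [?|/eqP vw] := eqVneq v w.
    by subst w; right; exists (inl (inr (k, v))).
  pose p : J := (k, v, w).
  have /andP[xl xh] : word_prod_lo lam p <= x * y <= word_prod_hi lam p by [].
  have [xl'|xl'] := ltP (x * y) (word_prod_lo lam' p).
    by right; exists (inr (inl p)); exact: between (lo p) (lo' p) xl (ltW xl').
  have [xh'|xh'] := ltP (word_prod_hi lam' p) (x * y).
    by right; exists (inr (inr p)); exact: between (hi' p) (hi p) (ltW xh') xh.
  left; apply: (word_prod_subset (k := k) m1 lamP' glam' pv pw vw).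
  by apply/andP; split.
have c0 : 0 <= c by apply: le_trans lamc'.
rewrite leeD2l// lee_fin !big_sumType /=; apply: lerD; first apply: lerD.
- by rewrite sumr_const card_unit mulr1n subr0 lerXn2r ?nnegrE.
- apply: (@le_trans _ _ (\sum_(p : 'I_N * n.+1.-tuple 'I_m) lam ^+ n.+1 *+ 3)).
    by apply: ler_sum => p _; case/andP: (diag_len p).
  (* There are [N * m ^ n.+1] squares, and [m ^ n.+1] times [lam ^+ n.+1] is at most [c ^+ n.+1]. *)
  rewrite sumr_const card_prod card_ord card_tuple card_ord -mulrnA.
  rewrite mulnA [X in _ *+ X]mulnC mulrnA lerMn2r; apply/orP; right.
  rewrite -mulr_natl natrX -exprMn lerXn2r ?nnegrE// mulr_ge0//.
- have widen (f : J -> R) : 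
      \sum_p (f p + eta - (f p - eta)) = eta *+ (2 * #|{: J}|).
    under eq_bigr do rewrite opprB addrC addrA subrK -mulr2n.
    by rewrite sumr_const -mulrnA.
  by rewrite !widen -mulrnDr -mulnDl.
Qed.

(** * Continuity in the ratio *)

Lemma cantor_point_continuous (R : realType) (m : nat) (w : seq 'I_m) :
  continuous (fun lam : R => cantor_point lam w).
Proof.
move=> x; elim: w => [|i w IH] /=; first exact: cvg_cst.
have stepC : cantor_step m lam @[lam --> x] --> (cantor_step m x : R).
  apply: cvgD; first exact: cvg_id.
  apply: cvgMr_tmp; apply: cvgB; first exact: cvg_cst.
  by apply: cvgMl_tmp; exact: cvg_id.
apply: cvgD; first by apply: cvgM IH; exact: cvg_id.
exact: cvgMl_tmp stepC.
Qed.

Lemma word_prod_lo_continuous (R : realType) (m N n : nat)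
    (p : 'I_N * n.-tuple 'I_m * n.-tuple 'I_m) :
  continuous (fun lam : R => word_prod_lo lam p).
Proof.
move=> x; apply: cvgM; first exact: exprn_continuous.
by apply: cvgM; exact: cantor_point_continuous.
Qed.

Lemma word_prod_hi_continuous (R : realType) (m N n : nat)
    (p : 'I_N * n.-tuple 'I_m * n.-tuple 'I_m) :
  continuous (fun lam : R => word_prod_hi lam p).
Proof.
move=> x; apply: cvgM; first exact: exprn_continuous.
by apply: cvgM; apply: cvgD;
  [exact: cantor_point_continuous | exact: exprn_continuous
  |exact: cantor_point_continuous | exact: exprn_continuous].
Qed.

Lemma expr_le_eps (R : realType) (c e : R) :
  0 <= c < 1 -> 0 < e -> exists n, c ^+ n.+1 <= e.
Proof.
move=> /andP[c0 c1] e0.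
have : (fun n => c ^+ n) @ \oo --> (0 : R) by apply: cvg_expr; rewrite ger0_norm.
move=> /cvgr0_norm_lt /(_ e e0) [n _ /(_ n.+1 (leqnSn n))] /= /ltW cn.
by exists n; exact: le_trans (ler_norm _) cn.
Qed.

Unset Implicit Arguments.
Set Strict Implicit.

Theorem theorem2 (R : realType) (m : nat) (hm : (2 <= m)%N) :
  {within `[(m.+1%:R)^-1, (m%:R)^-1[ : set R,
    continuous (fun lam : R =>
      lebesgue_measure (set_mul (uniform_cantor m lam) (uniform_cantor m lam)))}.
Proof.
set A := [set` _]; set f := (fun _ => _).
have mR0 : 0 < m%:R :> R by rewrite ltr0n ltnW.
have AP lam : A lam -> 0 < lam < m%:R^-1 /\ cantor_gap m lam <= lam.
  rewrite /A /= in_itv /= => /andP[lam1 lamm]; split; last exact: cantor_gap_le.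
  by rewrite lamm andbT (lt_le_trans _ lam1)// invr_gt0 ltr0n.
have f_fin lam : A lam -> f lam \is a fin_num.
  move=> /AP[lamP _]; have [_ cK _] := uniform_cantor_attractor hm lamP.
  rewrite ge0_fin_numE; last exact: measure_ge0.
  by apply: compact_finite_measure; exact: compact_set_mul.
rewrite continuous_subspace_in => x /set_mem Ax.
have [xP gx] := AP x Ax; have /andP[x0 xm] := xP.
apply: cvg_trans (_ : f @ within A (nbhs x) --> f x).
  by apply: cvg_app; rewrite nbhs_subspace_in.
(* The measure is extended-real valued; finiteness on [A] reduces the limit to real numbers. *)
rewrite -[f x]fineK ?f_fin//.
apply/fine_cvgP; split.
  by rewrite near_withinE; apply: nearW; exact: f_fin.
apply/cvgrPdist_le => e e0.
(* The midpoint of [m * x] and 1, so that [m * lam <= c < 1] for [lam] near [x]. *)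
pose c := (m%:R * x + 1) / 2.
have mx1 : m%:R * x < 1 by rewrite mulrC -ltr_pdivlMr ?div1r.
have mx0 : 0 < m%:R * x by rewrite mulr_gt0.
have c01 : 0 <= c < 1 by apply/andP; rewrite /c; split; lra.
have e3 : 0 < e / 3 by rewrite divr_gt0.
(* Each error term gets [e / 3]: first [N], then [n] depending on [N], then [eta] depending on the
   number of word products. *)
have [N cN] := expr_le_eps c01 e3.
have [n cn] : exists n, c ^+ n.+1 *+ (3 * N.+1) <= e / 3.
  have d0 : 0 < e / 3 / (3 * N.+1)%:R by rewrite divr_gt0// ltr0n.
  have [n] := expr_le_eps c01 d0; exists n.
  by rewrite -mulr_natr -ler_pdivlMr// ltr0n.
pose J : finType := ('I_N.+1 * n.+1.-tuple 'I_m * n.+1.-tuple 'I_m)%type.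
pose K := (4 * #|J|)%N.
pose eta := e / 3 / K.+1%:R.
have eta0 : 0 < eta by rewrite divr_gt0// ltr0n.
have etaK : eta *+ K <= e / 3.
  by rewrite -mulr_natr -[leRHS](@divfK _ K.+1%:R)// ler_pM2l// ler_nat.
have err : c ^+ N.+1 + c ^+ n.+1 *+ (3 * N.+1) + eta *+ K <= e by lra.
have near_c : \forall lam \near x, m%:R * lam <= c.
  have xc : m%:R * x < c by rewrite /c; lra.
  have : m%:R * lam @[lam --> x] --> m%:R * x by apply: cvgMl_tmp; exact: cvg_id.
  by move=> /cvgr_le; apply.
(* Uniformity in [p] is free because [J] is finite. *)
have near_unif (g : R -> J -> R) : (forall p, continuous (g^~ p)) ->
    \forall lam \near x, forall p, `|g lam p - g x p| <= eta.
  move=> gC; have gp p : \forall lam \near x, `|g lam p - g x p| <= eta.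
    by have /cvgr_distC_le := gC p x; apply.
  exact: (filter_forall (nbhs_filter x) gp).
have near_lo := near_unif (fun lam => @word_prod_lo R m N.+1 n.+1 lam)
  (@word_prod_lo_continuous R m N.+1 n.+1).
have near_hi := near_unif (fun lam => @word_prod_hi R m N.+1 n.+1 lam)
  (@word_prod_hi_continuous R m N.+1 n.+1).
rewrite near_withinE.
near=> lam => Alam.
have [lamP glam] := AP lam Alam.
have lamc : m%:R * lam <= c by near: lam.
have lo : forall p : J, `|word_prod_lo lam p - word_prod_lo x p| <= eta by near: lam.
have hi : forall p : J, `|word_prod_hi lam p - word_prod_hi x p| <= eta by near: lam.
have xc : m%:R * x <= c by rewrite /c; lra.
(* The reference endpoints are those at [x], so the conditions at [x] itself are trivial and the
   estimate can be used with [x] and [lam] in either role. *)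
have self (g : J -> R) p :
  `|g p - g p| <= eta by rewrite subrr normr0 ltW.
have upper := cantor_prod_measure_le hm lamP xP gx lamc (ltW eta0) lo
  (self _) hi (self _).
have lower := cantor_prod_measure_le hm xP lamP glam xc (ltW eta0)
  (self _) lo (self _) hi.
have fx := f_fin x Ax; have flam := f_fin lam Alam.
move: upper lower; rewrite -/(f x) -/(f lam) -(fineK fx) -(fineK flam).
rewrite -!EFinD !lee_fin /= => upper lower.
by rewrite ler_distl; apply/andP; split; rewrite -/K in upper lower; lra.
Unshelve. all: by end_near.
Qed.
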